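(* Let $p$ be a prime and $q=p^2$, and let $\vec r=(r_1,r_2)$ be integers with $0\le r_1,r_2<p$ and $r_1+r_2<p$. Then, as $\mathrm{GL}_2(\mathbb F_p)$-representations, $$\left(V_{\vec r}|_{\mathrm{GL}_2(\mathbb F_p)}\right)^{\mathrm{ss}}\cong (V_{r_1}\otimes V_{r_2})^{\mathrm{ss}}\cong V_{r_1+r_2}\oplus V_{r_1+r_2-2}(1)\oplus\cdots\oplus V_{|r_1-r_2|}(\min\{r_1,r_2\})=\bigoplus_{i=0}^{\min\{r_1,r_2\}}V_{r_1+r_2-2i}(i),$$ where $(\cdot)^{\mathrm{ss}}$ denotes semisimplification.
   Context: All representations are over a fixed algebraic closure $\overline{\mathbb F}_p$ of $\mathbb F_p$. For $r\ge 0$, $\mathrm{Sym}^r(\overline{\mathbb F}_p^2)$ is the $(r+1)$-dimensional space of homogeneous polynomials of degree $r$ in two variables $x,y$ over $\overline{\mathbb F}_p$, with $\begin{pmatrix}a&b\\c&d\end{pmatrix}\cdot P(x,y)=P(ax+cy,bx+dy)$. As a representation of $\mathrm{GL}_2(\mathbb F_p)$, $V_r(k)=\mathrm{Sym}^r(\overline{\mathbb F}_p^2)\otimes\det^k$ and $V_r=V_r(0)$. For $q=p^2$ and $\vec r=(r_1,r_2)$, $V_{\vec r}$ is the representation of $\mathrm{GL}_2(\mathbb F_q)$ on $\mathrm{Sym}^{r_1}(\overline{\mathbb F}_p^2)\otimes\mathrm{Sym}^{r_2}(\overline{\mathbb F}_p^2)$ in which $\begin{pmatrix}a&b\\c&d\end{pmatrix}$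 acts on the first factor by $P(x,y)\mapsto P(ax+cy,bx+dy)$ and on the second factor through $\begin{pmatrix}a^{p}&b^{p}\\c^{p}&d^{p}\end{pmatrix}$, i.e. by $P(x,y)\mapsto P(a^px+c^py,b^px+d^py)$. The semisimplification of a finite-dimensional representation is the direct sum of its composition factors, counted with multiplicity. *)

(* Defs.v *)
From HB Require Import structures.
From Stdlib Require Import ClassicalEpsilon.
From mathcomp Require Import all_boot all_order all_algebra all_fingroup.
From mathcomp Require Import all_solvable all_field all_character.
From mathcomp.multinomials Require Import mpoly.

Set Implicit Arguments.
Unset Strict Implicit.
Unset Printing Implicit Defensive.

Import GRing.Theory.
Local Open Scope group_scope.
Local Open Scope ring_scope.

(* Polynomials in x = 'X_0 and y = 'X_1.  For g = [[a, b], [c, d]],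
   lin_subst g P is P(ax + cy, bx + dy). *)
Section HomogeneousPolynomials.
Variable K : fieldType.

Definition lin_subst (g : 'M[K]_2) (P : {mpoly K[2]}) : {mpoly K[2]} :=
  P \mPo [tuple \sum_(i < 2) g i j *: 'X_i | j < 2].

(* The exponent of the i-th basis monomial x^(r-i) y^i of Sym^r. *)
Definition sym_mon (r : nat) (i : 'I_r.+1) : 'X_{1..2} :=
  [multinom (if j == 0%R :> 'I_2 then r - i else i)%N | j < 2].

(* The matrix of lin_subst g on Sym^r: its j-th COLUMN lists the coordinates
   of lin_subst g (x^(r-j) y^j) in the monomial basis (see sym_mxP), so that
   g |-> sym_mx r g is multiplicative. *)
Definition sym_mx (r : nat) (g : 'M[K]_2) : 'M[K]_r.+1 :=
  \matrix_(i, j) (lin_subst g 'X_[sym_mon j])@_(sym_mon i).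

Lemma mdeg_sym_mon r (i : 'I_r.+1) : mdeg (sym_mon i) = r.
Proof.
by rewrite mdegE !big_ord_recl big_ord0 !mnmE /= addn0 subnK // -ltnS.
Qed.

Lemma sym_mon_inj r : injective (@sym_mon r).
Proof.
move=> i j /mnmP /(_ (lift ord0 ord0)); rewrite !mnmE /= => eq_ij.
exact: val_inj.
Qed.

Lemma sym_mon_onto r (m : 'X_{1..2}) :
  mdeg m = r -> exists i : 'I_r.+1, m = sym_mon i.
Proof.
rewrite mdegE !big_ord_recl big_ord0 addn0 => def_r.
have lt_m : (m (lift ord0 ord0) < r.+1)%N by rewrite ltnS -def_r leq_addl.
exists (Ordinal lt_m); apply/mnmP => j; rewrite mnmE /=.
case: eqP => [-> | /eqP nz_j]; first by rewrite -def_r addnK.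
congr (m _); apply/val_inj; case: j nz_j => [[|[|j]]] //=.
Qed.

Lemma homog_symE r (P : {mpoly K[2]}) : P \is r.-homog ->
  P = \sum_(i < r.+1) P@_(sym_mon i) *: 'X_[sym_mon i].
Proof.
move=> homP; apply/mpolyP => m; rewrite raddf_sum /=.
under eq_bigr do rewrite mcoeffZ mcoeffX.
have [/sym_mon_onto[i ->] | ne_m] := eqVneq (mdeg m) r.
  rewrite (bigD1 i) //= eqxx mulr1 big1 ?addr0 // => j ne_ji.
  by rewrite (inj_eq (@sym_mon_inj r)) (negPf ne_ji) mulr0.
rewrite (dhomog_nemf_coeff homP ne_m) big1 // => i _.
case: eqP => [def_m | _]; last by rewrite mulr0.
by rewrite -def_m mdeg_sym_mon eqxx in ne_m.
Qed.

Lemma lin_substX g (j : 'I_2) :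
  lin_subst g 'X_j = \sum_(i < 2) g i j *: 'X_i.
Proof. by rewrite /lin_subst comp_mpolyXU -tnth_nth tnth_mktuple. Qed.

Lemma lin_subst_homog r g (P : {mpoly K[2]}) :
  P \is r.-homog -> lin_subst g P \is r.-homog.
Proof.
move=> homP; rewrite (homog_symE homP) /lin_subst raddf_sum rpred_sum //= => i _.
rewrite comp_mpolyZ rpredZ // comp_mpolyX.
have lin_homog j : tnth [tuple \sum_(i < 2) g i j *: 'X_i | j < 2] j
    \is [in K[2], 1.-homog].
  rewrite tnth_mktuple rpred_sum // => k _; rewrite rpredZ //.
  by rewrite dhomogX /= mdeg1.
suff: \prod_(k < 2)
    tnth [tuple \sum_(i < 2) g i j *: 'X_i | j < 2] k ^+ sym_mon i k
  \is [in K[2], (mdeg (sym_mon i)).-homog] by rewrite mdeg_sym_mon.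
rewrite mdegE !big_ord_recl !big_ord0 addn0 mulr1.
have homXn k (e : nat) :
    tnth [tuple \sum_(i < 2) g i j *: 'X_i | j < 2] k ^+ e
      \is [in K[2], e.-homog].
  by have := dhomogMn e (lin_homog k); rewrite mul1n.
by apply: dhomogM; apply: homXn.
Qed.

Lemma lin_subst_mul g h (P : {mpoly K[2]}) :
  lin_subst (g *m h) P = lin_subst g (lin_subst h P).
Proof.
have lin_subst_sum k : lin_subst k P =
    \sum_(m <- msupp P) P@_m *:
      ('X_[m] \mPo [tuple \sum_(i < 2) k i j *: 'X_i | j < 2]).
  rewrite /lin_subst [P in LHS]mpolyE raddf_sum /=.
  by apply: eq_bigr => m _; rewrite comp_mpolyZ.
rewrite !lin_subst_sum /lin_subst raddf_sum /=.
apply: eq_bigr => m _; rewrite comp_mpolyZ; congr (_ *: _).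
rewrite !comp_mpolyX rmorph_prod; apply: eq_bigr => j _.
rewrite rmorphXn /=; congr (_ ^+ _); rewrite !tnth_mktuple raddf_sum /=.
under [RHS]eq_bigr => k _.
  rewrite comp_mpolyZ -/(lin_subst g _) lin_substX scaler_sumr.
  under eq_bigr do rewrite scalerA. over.
rewrite exchange_big; apply: eq_bigr => i _ /=.
by rewrite mxE scaler_suml; apply: eq_bigr => k _; rewrite mulrC.
Qed.

Lemma sym_mxP r g (P : {mpoly K[2]}) : P \is r.-homog ->
  (\col_i (lin_subst g P)@_(@sym_mon r i)) =
    sym_mx r g *m (\col_i P@_(@sym_mon r i)).
Proof.
move=> homP; apply/matrixP => i j; rewrite !mxE.
rewrite [P in LHS](homog_symE homP) /lin_subst (raddf_sum (comp_mpoly _)) /=.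
rewrite (raddf_sum (mcoeff _)) /=.
apply: eq_bigr => k _; rewrite comp_mpolyZ mcoeffZ !mxE.
by rewrite mulrC.
Qed.

Lemma sym_mxM r g h : sym_mx r (g *m h) = sym_mx r g *m sym_mx r h.
Proof.
apply/matrixP => i j; rewrite mxE lin_subst_mul.
have homX : lin_subst h 'X_[sym_mon j] \is r.-homog.
  by rewrite lin_subst_homog // dhomogX /= mdeg_sym_mon.
have /matrixP/(_ i 0) := sym_mxP g homX; rewrite mxE => ->.
by rewrite !mxE; apply: eq_bigr => k _; rewrite !mxE.
Qed.

Lemma sym_mx1 r : sym_mx r 1%:M = 1%:M.
Proof.
apply/matrixP => i j; rewrite !mxE /lin_subst.
rewrite (_ : [tuple _ | j < 2] = [tuple 'X_k | k < 2]).
  by rewrite comp_mpoly_id mcoeffX (inj_eq (@sym_mon_inj r)) eq_sym.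
apply: eq_from_tnth => k; rewrite !tnth_mktuple (bigD1 k) //= mxE eqxx scale1r.
by rewrite big1 ?addr0 // => l ne_lk; rewrite mxE (negPf ne_lk) scale0r.
Qed.

End HomogeneousPolynomials.

Section GL2Representations.
Variables (K : fieldType) (F : finFieldType) (sigma : {rmorphism F -> K}).

Lemma sym_mx_repr r :
  mx_repr 'GL_2[F] (fun g => sym_mx r (map_mx sigma (GLval g))).
Proof.
split=> [|g h _ _]; first by rewrite GL_1E map_mx1 sym_mx1.
by rewrite GL_MxE map_mxM sym_mxM.
Qed.

(* Sym^r(K^2), with GL_2(F) acting through sigma. *)
Definition Sym_repr (r : nat) : representation K 'GL_2[F]%G :=
  Representation (MxRepresentation (sym_mx_repr r)).

Lemma det_mx_repr k :
  mx_repr 'GL_2[F] (fun g => (sigma (\det (GLval g)) ^+ k)%:M : 'M[K]_1).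
Proof.
split=> [|g h _ _]; first by rewrite GL_1E det1 rmorph1 expr1n.
by rewrite GL_MxE det_mulmx rmorphM exprMn scalar_mxM.
Qed.

Definition det_repr (k : nat) : representation K 'GL_2[F]%G :=
  Representation (MxRepresentation (det_mx_repr k)).

End GL2Representations.

Definition tensor_repr (K : fieldType) (gT : finGroupType) (G : {group gT})
    (rG1 rG2 : representation K G) : representation K G :=
  Representation (prod_repr rG1 rG2).

(* V_r(k) = Sym^r (x) det^k *)
Definition V_twist (K : fieldType) (F : finFieldType)
    (sigma : {rmorphism F -> K}) (r k : nat) : representation K 'GL_2[F]%G :=
  tensor_repr (Sym_repr sigma r) (det_repr sigma k).

(* V_(r1, r2): on the second factor g acts through its entrywise p-th power. *)
Definition V_pair (K : fieldType) (F : finFieldType) (p : nat)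
    (charF : p \in [pchar F]) (sigma : {rmorphism F -> K}) (r1 r2 : nat) :
    representation K 'GL_2[F]%G :=
  tensor_repr (Sym_repr sigma r1) (Sym_repr (sigma \o pFrobenius_aut charF) r2).

Section Restriction.
Variables (F0 F : finFieldType) (j : {rmorphism F0 -> F}).

Lemma GL2_map_unit (g : {'GL_2[F0]}) : map_mx j (GLval g) \is a GRing.unit.
Proof. by rewrite -[_ \is a _]/(_ \in unitmx) map_unitmx; apply: GL_unitmx. Qed.

Definition GL2_map (g : {'GL_2[F0]}) : {'GL_2[F]} :=
  FinRing.unit _ (GL2_map_unit g).

Lemma GL2_mapM : {in 'GL_2[F0] &, {morph GL2_map : g h / (g * h)%g}}.
Proof.
by move=> g h _ _; apply: val_inj; exact: (map_mxM j (GLval g) (GLval h)).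
Qed.

Canonical GL2_map_morphism := Morphism GL2_mapM.

Lemma GL2_map_sub : 'GL_2[F0] \subset GL2_map @*^-1 'GL_2[F].
Proof. by apply/subsetP => g _; rewrite !inE. Qed.

Definition restrict_GL2 (K : fieldType) (rG : representation K 'GL_2[F]%G) :
    representation K 'GL_2[F0]%G :=
  Representation
    (subg_repr (morphpre_repr GL2_map_morphism rG) GL2_map_sub).

End Restriction.

Section Semisimplification.
Variables (K : fieldType) (gT : finGroupType) (G : {group gT}).
Implicit Types rG S : representation K G.

(* mx_composition_series only asks for maximal strict inclusions starting from
   0; the series must also reach the whole space.  MathComp's submodules are
   spaces of row vectors stable under right multiplication.  A full series
   block-triangularises rG, and its section representations are the diagonal
   blocks; for the action on column vectors these are also the composition
   factors, the series of column submodules being that of the annihilators. *)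
Definition is_semisimplification rG S : Prop :=
  exists (U : seq 'M[K]_(rdegree rG)) (compU : mx_composition_series rG U),
    (last 0 U :=: 1%:M)%MS /\
    mx_rsim S (\big[@dadd_grepr K gT G/grepr0]_(i < size U)
                 Representation (series_repr i compU)).

Lemma semisimplification_exists rG : exists S, is_semisimplification rG S.
Proof.
have [//|noS] := classic (exists S, is_semisimplification rG S).
suff: false by [].
apply: (@mx_Schreier K gT G _ rG [::] isT isT) => -[U [compU lastU _]].
case: noS.
exists (\big[@dadd_grepr K gT G/grepr0]_(i < size U)
          Representation (series_repr i compU)), U, compU.
by split=> //; apply: mx_rsim_refl.
Qed.

Definition semisimplification rG : representation K G :=
  proj1_sig (constructive_indefinite_description _
    (semisimplification_exists rG)).

Lemma semisimplificationP rG :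
  is_semisimplification rG (semisimplification rG).
Proof. exact: proj2_sig. Qed.

Lemma mx_rsim_daddr (A A' B B' : representation K G) :
  mx_rsim A A' -> mx_rsim B B' ->
  mx_rsim (dadd_grepr A B) (dadd_grepr A' B').
Proof.
move=> [f eqA injf homf] [h eqB injh homh].
exists (block_mx f 0 0 h) => [||x Gx] /=; first by rewrite eqA eqB.
  by rewrite /row_free rank_diag_block_mx (eqP injf) (eqP injh).
by rewrite !mulmx_block !(mulmx0, mul0mx, addr0, add0r) homf ?homh.
Qed.

Lemma mx_rsim_daddCA (A B C : representation K G) :
  mx_rsim (dadd_grepr A (dadd_grepr B C)) (dadd_grepr B (dadd_grepr A C)).
Proof.
pose M (a b c : nat) : 'M[K]_(a + (b + c), b + (a + c)) :=
  block_mx 0 (row_mx 1%:M 0) (col_mx 1%:M 0) (block_mx 0 0 0 1%:M).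
have MK a b c : M a b c *m M b a c = 1%:M.
  rewrite /M mulmx_block mul_row_col mul_row_block mul_col_row.
  rewrite mul_block_col mulmx_block.
  rewrite !(mulmx0, mul0mx, mulmx1, mul1mx, addr0, add0r, row_mx0, col_mx0).
  by rewrite add_block_mx !(addr0, add0r) -!scalar_mx_block.
exists (M (rdegree A) (rdegree B) (rdegree C)) => [||x Gx] /=.
- by rewrite addnCA.
- by apply/row_freeP; exists (M (rdegree B) (rdegree A) (rdegree C)); apply: MK.
rewrite /M !mulmx_block !(mul_row_block, mul_block_col, mul_mx_row, mul_col_mx).
rewrite !(mulmx_block, mulmx0, mul0mx, mulmx1, mul1mx, addr0, add0r).
by rewrite row_mx0 col_mx0 col_mx0 !(addr0, add0r).
Qed.

Lemma mx_rsim_big_seq (I : Type) (s : seq I) (A B : I -> representation K G) :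
  (forall i, mx_rsim (A i) (B i)) ->
  mx_rsim (\big[@dadd_grepr K gT G/grepr0]_(i <- s) A i)
          (\big[@dadd_grepr K gT G/grepr0]_(i <- s) B i).
Proof.
move=> simAB; elim: s => [|i s IHs]; first by rewrite !big_nil; apply: mx_rsim_refl.
by rewrite !big_cons; apply: mx_rsim_daddr.
Qed.

Lemma mx_rsim_big_perm (I : eqType) (s t : seq I) (A : I -> representation K G) :
  perm_eq s t ->
  mx_rsim (\big[@dadd_grepr K gT G/grepr0]_(i <- s) A i)
          (\big[@dadd_grepr K gT G/grepr0]_(i <- t) A i).
Proof.
elim: s t => [|x s IHs] t.
  by rewrite perm_sym => /perm_nilP->; apply: mx_rsim_refl.
move=> st; have tx : x \in t by rewrite -(perm_mem st) mem_head.
case/splitPr: tx st => t1 t2.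
rewrite perm_sym perm_catC /= perm_cons perm_catC perm_sym => /IHs st12.
rewrite big_cons; apply: mx_rsim_trans (mx_rsim_daddr (mx_rsim_refl _) st12) _.
elim: t1 {st12} => [|y t1 IHt1] /=; first by rewrite big_cons; apply: mx_rsim_refl.
rewrite !big_cons; apply: mx_rsim_trans (mx_rsim_daddCA _ _ _) _.
exact: mx_rsim_daddr (mx_rsim_refl _) IHt1.
Qed.

Lemma semisimplification_unique rG S S' :
  is_semisimplification rG S -> is_semisimplification rG S' -> mx_rsim S S'.
Proof.
move=> [U [compU [lastU simS]]] [V [compV [lastV simS']]].
have eqUV : (last 0 U :=: last 0 V)%MS by apply: eqmx_trans lastU (eqmx_sym lastV).
have [eq_sz [s sim_s]] := mx_JordanHolder compU compV eqUV.
apply: mx_rsim_trans simS (mx_rsim_trans _ (mx_rsim_sym simS')).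
pose A (i : nat) := Representation (series_repr i compV).
apply: mx_rsim_trans (_ : mx_rsim _ (\big[@dadd_grepr K gT G/grepr0]_i A (s i))) _.
  exact: mx_rsim_big_seq.
rewrite -eq_sz -(big_map s xpredT (fun i : 'I_(size U) => A i)).
apply: mx_rsim_big_perm; apply: uniq_perm.
- by rewrite (map_inj_uniq (@perm_inj _ s)) index_enum_uniq.
- exact: index_enum_uniq.
move=> i; rewrite mem_index_enum; apply/mapP.
by exists ((s^-1)%g i); rewrite ?mem_index_enum ?permKV.
Qed.

End Semisimplification.

(* Main.v *)
(* The maps T_i : V_r1 (x) V_r2 -> V_(r1+r2-2i)(i), P (x) Q |-> i-th transvectant
   of P and Q, are GL_2-equivariant by the chain rule, and nonzero because
   x^r1 (x) y^r2 is sent to r1^_i r2^_i x^(r1-i) y^(r2-i) with r1, r2 < p.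
   Their targets are irreducible since r1 + r2 < p, and pairwise
   non-isomorphic because their dimensions differ.  For the row-vector
   convention of MathComp, the row spaces of the matrices of the T_i are then
   simple submodules in direct sum, and by dimension count they fill the whole
   tensor product.  The restriction to GL_2(F_p) of V_(r1,r2) has literally the
   same matrices as V_r1 (x) V_r2, since Frobenius is trivial on F_p. *)
From HB Require Import structures.
Require Import Defs.
From mathcomp Require Import all_boot all_order all_algebra all_fingroup.
From mathcomp Require Import all_solvable all_field all_character.
From mathcomp.multinomials Require Import mpoly.
From mathcomp Require Import ring zify.

Set Implicit Arguments.
Unset Strict Implicit.
Unset Printing Implicit Defensive.

Import GRing.Theory.
Local Open Scope ring_scope.

(** * Composition series built from equivariant maps out of irreducibles *)

Section CompositionFactors.
Variables (K : fieldType) (gT : finGroupType) (G : {group gT}).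

(** Schur: the kernel of [B] is a submodule of [rS], and a nonzero one would be everything, forcing
    [B] to vanish. *)
Lemma irr_hom_row_free d n (rS : mx_representation K G d)
    (rG : mx_representation K G n) (B : 'M_(d, n)) :
  mx_irreducible rS -> B != 0 ->
  (forall g, g \in G -> rS g *m B = B *m rG g) -> row_free B.
Proof.
case/mx_irrP=> _ irrS nzB homB; rewrite -kermx_eq0.
apply: contraR nzB => /irrS full_ker.
suff /full_ker: mxmodule rS (kermx B).
  by rewrite -sub1mx => /sub_kermxP <-; rewrite mul1mx.
apply/mxmoduleP => g Gg; apply/sub_kermxP.
by rewrite -mulmxA homB // mulmxA mulmx_ker mul0mx.
Qed.

Lemma hom_mxmodule_image d n (rS : mx_representation K G d)
    (rG : mx_representation K G n) (B : 'M_(d, n)) :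
  (forall g, g \in G -> rS g *m B = B *m rG g) -> mxmodule rG B.
Proof.
by move=> homB; apply/mxmoduleP => g Gg; rewrite -homB // submxMl.
Qed.

Lemma mx_rsim_hom_image d n (rS : mx_representation K G d)
    (rG : mx_representation K G n) (B : 'M_(d, n)) M
    (modM : mxmodule rG M) :
  row_free B -> (B :=: M)%MS ->
  (forall g, g \in G -> rS g *m B = B *m rG g) ->
  mx_rsim (submod_repr modM) rS.
Proof.
move=> freeB eqBM homB; apply: mx_rsim_sym.
have sBM : (B <= M)%MS by rewrite eqBM.
exists (in_submod M B) => [||g Gg].
- by rewrite -eqBM (eqP freeB).
- apply/eqP/anti_leq; rewrite rank_leq_row /= -{1}(eqP freeB).
  by rewrite -{1}(in_submodK sBM) val_submodE mxrankM_maxl.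
rewrite -in_submodJ // -homB //.
by rewrite [in_submod _ B]in_submodE [in RHS]in_submodE mulmxA.
Qed.

(** Followed by the projection modulo [U], the map [B] stays equivariant, and it is nonzero because
    its image is not inside [U]. By Schur it is injective, and its image is [V] modulo [U]. *)
Lemma mx_rsim_section_hom d n (rS : mx_representation K G d)
    (rG : mx_representation K G n) (B : 'M_(d, n)) U V
    (modU : mxmodule rG U) (modV : mxmodule rG V) :
  mx_irreducible rS -> ~~ (B <= U)%MS -> (U + B :=: V)%MS ->
  (forall g, g \in G -> rS g *m B = B *m rG g) ->
  mx_rsim (section_repr modU modV) rS.
Proof.
move=> irrS nBU defV homB.
have homBU g : g \in G ->
    rS g *m in_factmod U B = in_factmod U B *m factmod_repr modU g.
  move=> Gg; rewrite -[factmod_repr _ _]/(factmod_mx modU g) -in_factmodJ //.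
  by rewrite -homB // [in LHS]in_factmodE [in RHS]in_factmodE mulmxA.
have freeB : row_free (in_factmod U B).
  by apply: irr_hom_row_free homBU; rewrite ?in_factmod_eq0.
apply: (mx_rsim_hom_image _ freeB) => //.
apply: eqmx_trans (eqmx_sym (genmxE _)); apply/eqmxP.
have sUV : (B <= V)%MS by rewrite -defV addsmxSr.
rewrite [in_factmod U B]in_factmodE [in_factmod U V]in_factmodE submxMr //=.
rewrite -(eqmxMr _ defV) addsmxMr addsmx_sub submx_refl andbT.
by rewrite -in_factmodE (eqP (_ : in_factmod U U == 0)) ?sub0mx ?in_factmod_eq0.
Qed.

Section DistinctDegrees.
Variables (rG : representation K G) (m : nat).
Variables (S : nat -> representation K G).
Variables (A : forall i, 'M[K]_(rdegree (S i), rdegree rG)).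
Hypothesis irrS : forall i, (i < m)%N -> mx_irreducible (S i).
Hypothesis nzA : forall i, (i < m)%N -> A i != 0.
Hypothesis homA : forall i, (i < m)%N ->
  forall g, g \in G -> S i g *m A i = A i *m rG g.
Hypothesis degS : forall i j, (i < j < m)%N -> rdegree (S i) != rdegree (S j).
Hypothesis deg_rG : (\sum_(i < m) rdegree (S i))%N = rdegree rG.

Let M i := <<A i>>%MS.
(** These partial sums form the composition series of [rG]; the factor between [U k] and [U k.+1]
    will be [S k]. *)
Let U k := (\sum_(i < k) M i)%MS.

Let modM i : (i < m)%N -> mxmodule rG (M i).
Proof.
move=> lt_im; rewrite (eqmx_module _ (genmxE _)).
exact: hom_mxmodule_image (homA lt_im).
Qed.

Let freeA i : (i < m)%N -> row_free (A i).
Proof.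
by move=> lt_im; apply: irr_hom_row_free (homA lt_im); [apply: irrS | apply: nzA].
Qed.

Let simM i : (i < m)%N -> mxsimple rG (M i).
Proof.
move=> lt_im; apply/(submod_mx_irr (modM lt_im)).
apply: mx_rsim_irr (irrS lt_im); apply: mx_rsim_sym.
by apply: (mx_rsim_hom_image _ (freeA lt_im) _ (homA lt_im)); apply/eqmx_sym/genmxE.
Qed.

Let modU k : (k <= m)%N -> mxmodule rG (U k).
Proof.
by move=> le_km; apply: sumsmx_module => i _; apply: modM (leq_trans _ le_km).
Qed.

Let US k : (U k + A k :=: U k.+1)%MS.
Proof.
rewrite /U big_ord_recr /=.
exact: adds_eqmx (eqmx_refl _) (eqmx_sym (genmxE _)).
Qed.

(** A simple module inside a sum of simple modules is isomorphic to one of them. Here this would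
    equate the degrees of [S i] and [S k] for some [i < k]. *)
Let notin_U k : (k < m)%N -> ~~ (A k <= U k)%MS.
Proof.
move=> lt_km; apply/negP; rewrite -(genmxE (A k)) -/(M k) => sMU.
have simMi (i : 'I_k) : true -> M i != 0 -> mxsimple rG (M i).
  by move=> _ _; apply/simM/(ltn_trans (ltn_ord i)).
have [|i _] := @hom_mxsemisimple_iso _ _ _ _ rG 'I_k xpredT (M k) M 1%:M
    (simM lt_km) simMi (scalar_mx_hom _ _ _).
  by rewrite mulmx1.
move/mxrank_iso; rewrite !genmxE (eqP (freeA lt_km)).
rewrite (eqP (freeA (ltn_trans (ltn_ord i) lt_km))) => /eqP.
by apply/negP/degS; rewrite ltn_ord.
Qed.

Let section_U k (modUk : mxmodule rG (U k)) (modUk1 : mxmodule rG (U k.+1)) :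
  (k < m)%N -> mx_rsim (section_repr modUk modUk1) (S k).
Proof.
move=> lt_km; apply: mx_rsim_section_hom (US k) (homA lt_km).
  exact: irrS.
exact: notin_U.
Qed.

Let rank_U k : (k <= m)%N -> \rank (U k) = (\sum_(i < k) rdegree (S i))%N.
Proof.
elim: k => [|k IHk] le_km; first by rewrite /U !big_ord0 mxrank0.
have modUk := modU (ltnW le_km); have modUk1 := modU le_km.
have /mxrank_rsim := section_U modUk modUk1 le_km.
rewrite genmxE big_ord_recr /= => <-.
rewrite -(IHk (ltnW le_km)) addnC mxrank_in_factmod.
by rewrite (addsmx_idPr _) // -US addsmxSl.
Qed.

(** By uniqueness of the semisimplification, one composition series with the factors [S i]
    suffices. *)
Lemma semisimplification_distinct_degrees :
  mx_rsim (semisimplification rG)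
    (\big[@dadd_grepr K gT G/grepr0]_(i < m) S i).
Proof.
apply: semisimplification_unique (semisimplificationP rG) _.
(* A composition series leaves out its initial zero term, hence the shift to [k.+1]. *)
pose Us := mkseq (fun k => U k.+1) m.
have szU : size Us = m by rewrite size_mkseq.
have nthU i : (i < m)%N -> Us`_i = U i.+1 by apply: nth_mkseq.
have nthU0 i : (i < m)%N -> (0 :: Us)`_i = U i.
  by case: i => [|i] lt_im /=; rewrite ?nthU ?(ltnW lt_im) // /U big_ord0.
have section_Us i (mod0 : mxmodule rG (0 :: Us)`_i) (mod1 : mxmodule rG Us`_i) :
    (i < m)%N -> mx_rsim (section_repr mod0 mod1) (S i).
  move=> lt_im; move: mod0 mod1; rewrite nthU0 // nthU // => mod0 mod1.
  exact: section_U.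
have compU : mx_composition_series rG Us.
  have modUs : mx_subseries rG Us.
    by apply/(all_nthP 0); rewrite szU => i lt_im; rewrite nthU // modU.
  split=> // i; rewrite szU => lt_im.
  have mod0 : mxmodule rG (0 :: Us)`_i by rewrite nthU0 // modU // ltnW.
  have mod1 : mxmodule rG Us`_i by rewrite nthU // modU.
  apply/(max_submodP mod0 mod1).
    by rewrite nthU0 // nthU // -US addsmxSl.
  exact: mx_rsim_irr (mx_rsim_sym (section_Us _ _ _ lt_im)) (irrS lt_im).
exists Us, compU; split.
  have -> : last 0 Us = U m.
    rewrite (last_nth 0) szU; case: (m) szU nthU => [|n] szU nthU /=.
      by rewrite /U big_ord0.
    by rewrite nthU.
  (* The series reaches the whole space because the degrees of its factors add up to that of
     [rG]. *)
  apply/eqmxP; rewrite submx1 sub1mx /row_full rank_U // deg_rG.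
  exact: eqxx.
apply: mx_rsim_sym.
apply: mx_rsim_trans (_ : mx_rsim _
  (\big[@dadd_grepr K gT G/grepr0]_(i < size Us) S i)) _.
  apply: mx_rsim_big_seq => i; apply: section_Us.
  by rewrite -[m in (_ < m)%N]szU.
by rewrite szU; apply: mx_rsim_refl.
Qed.

End DistinctDegrees.
End CompositionFactors.

(** * Transvectants of binary forms: chain rule, equivariance, values on monomials *)

Lemma mpoly_alg_ind (n : nat) (R : comNzRingType) (H : {mpoly R[n]} -> Prop) :
  H 1 -> (forall i, H 'X_i) -> (forall P Q, H P -> H Q -> H (P + Q)) ->
  (forall c P, H P -> H (c *: P)) -> (forall P Q, H P -> H Q -> H (P * Q)) ->
  forall P, H P.
Proof.
move=> H1 HX HD HZ HM.
elim/mpolyind => [|c m P _ _ HP]; first by rewrite -(scale0r 1); apply: HZ.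
apply: HD HP; apply: HZ; rewrite mpolyXE_id.
elim/big_ind: _ => // i _.
by elim: (m i) => [|k IHk]; rewrite ?expr0 ?exprS //; apply: HM.
Qed.

Section Transvectants.
Variable K : fieldType.
Implicit Types (P Q : {mpoly K[2]}) (g : 'M[K]_2) (c : K).

Local Notation x := (@ord0 1).
Local Notation y := (@ord_max 1).

Lemma big_ord2 (V : nmodType) (F : 'I_2 -> V) : \sum_(i < 2) F i = F x + F y.
Proof.
rewrite !big_ord_recl big_ord0 addr0; congr (_ + F _); exact: val_inj.
Qed.

Lemma det_ord2 g : \det g = g x x * g y y - g x y * g y x.
Proof.
rewrite (expand_det_row _ x) big_ord2 /cofactor !det_mx11 !mxE /=.
rewrite expr0 expr1 mul1r mulN1r mulrN.
by congr (_ * g _ _ - _ * g _ _); exact: val_inj.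
Qed.

Lemma lin_substD g P Q : lin_subst g (P + Q) = lin_subst g P + lin_subst g Q.
Proof. exact: comp_mpolyD. Qed.

Lemma lin_substZ g c P : lin_subst g (c *: P) = c *: lin_subst g P.
Proof. exact: comp_mpolyZ. Qed.

Lemma lin_substM g P Q : lin_subst g (P * Q) = lin_subst g P * lin_subst g Q.
Proof. exact: rmorphM. Qed.

(** The chain rule. Both sides behave in the same way under sums, scalars and, by Leibniz, products,
    so it is enough to compare them on the variables. *)
Lemma mderiv_lin_subst g i P :
  (lin_subst g P)^`M(i) = \sum_(j < 2) g i j *: lin_subst g P^`M(j).
Proof.
elim/(@mpoly_alg_ind 2 K): P => [|k|P Q IHP IHQ|c P IHP|P Q IHP IHQ].
- rewrite /lin_subst rmorph1 mderivC big1 // => j _.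
  by rewrite mderivC raddf0 scaler0.
- have submm l : (U_(l) - U_(l) = 0 :> 'X_{1..2})%MM.
    by apply/mnmP => l'; rewrite mnmBE subnn mnm0E.
  rewrite lin_substX raddf_sum /= (bigD1 i) //= [in RHS](bigD1 k) //=.
  rewrite !mderivZ !mderivX !mnmE !eqxx !submm mpolyX0 !scale1r.
  rewrite /lin_subst rmorph1 !big1 // => j ne_j.
    rewrite mderivX mnmE eq_sym (negPf ne_j) scale0r.
    by rewrite raddf0 scaler0.
  by rewrite mderivZ mderivX mnmE (negPf ne_j) scale0r scaler0.
- rewrite lin_substD mderivD IHP IHQ -big_split; apply: eq_bigr => j _ /=.
  by rewrite mderivD lin_substD scalerDr.
- rewrite lin_substZ mderivZ IHP scaler_sumr; apply: eq_bigr => j _.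
  by rewrite mderivZ lin_substZ !scalerA mulrC.
rewrite lin_substM mderivM IHP IHQ mulr_suml mulr_sumr -big_split.
apply: eq_bigr => j _ /=.
by rewrite mderivM lin_substD !lin_substM scalerDr scalerAl scalerAr.
Qed.

Lemma mderiv_lin_subst2 g i P :
  (lin_subst g P)^`M(i) =
    g i x *: lin_subst g P^`M(x) + g i y *: lin_subst g P^`M(y).
Proof. by rewrite mderiv_lin_subst big_ord2. Qed.

Lemma mderiv_homog r i P : P \is r.+1.-homog -> P^`M(i) \is r.-homog.
Proof.
move=> homP; rewrite (homog_symE homP) raddf_sum rpred_sum //= => k _.
rewrite mderivZ mderivX rpredZ //.
(* If the variable does not occur, the truncated exponent has the wrong degree, but its coefficient
   is 0. *)
have [->|nz_i] := eqVneq (sym_mon k i) 0%N; first by rewrite scale0r rpred0.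
rewrite rpredZ // dhomogX /=; apply/eqP/(@addIn 1%N).
rewrite [RHS]addn1 -[RHS](mdeg_sym_mon k) -[X in (_ + X)%N](mdeg1 i) -mdegD.
by rewrite submK // lep1mP.
Qed.

(* The [n]-th transvectant: restriction to the diagonal of
   (d/dx (x) d/dy - d/dy (x) d/dx)^n applied to P (x) Q. *)
Fixpoint transvectant n P Q : {mpoly K[2]} :=
  if n is n'.+1
  then transvectant n' P^`M(x) Q^`M(y) - transvectant n' P^`M(y) Q^`M(x)
  else P * Q.

Lemma transvectant_linear_l n Q : linear (transvectant n ^~ Q).
Proof.
elim: n Q => [|n IHn] Q c P P' /=; first by rewrite mulrDl scalerAl.
rewrite !mderivD !mderivZ !IHn scalerBr opprD !addrA; congr (_ + _).
by rewrite -!addrA; congr (_ + _); rewrite addrC.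
Qed.

Lemma transvectant_linear_r n P : linear (transvectant n P).
Proof.
elim: n P => [|n IHn] P c Q Q' /=; first by rewrite mulrDr scalerAr.
rewrite !mderivD !mderivZ !IHn scalerBr opprD !addrA; congr (_ + _).
by rewrite -!addrA; congr (_ + _); rewrite addrC.
Qed.

Lemma transvectantDl n P P' Q :
  transvectant n (P + P') Q = transvectant n P Q + transvectant n P' Q.
Proof. by have := transvectant_linear_l n Q 1 P P'; rewrite !scale1r. Qed.

Lemma transvectant0l n Q : transvectant n 0 Q = 0.
Proof.
have := transvectant_linear_l n Q (-1) 0 0.
by rewrite scaler0 addr0 scaleN1r addNr.
Qed.

Lemma transvectantZl n c P Q :
  transvectant n (c *: P) Q = c *: transvectant n P Q.
Proof.
have := transvectant_linear_l n Q c P 0.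
by rewrite transvectant0l !addr0.
Qed.

Lemma transvectantDr n P Q Q' :
  transvectant n P (Q + Q') = transvectant n P Q + transvectant n P Q'.
Proof. by have := transvectant_linear_r n P 1 Q Q'; rewrite !scale1r. Qed.

Lemma transvectant0r n P : transvectant n P 0 = 0.
Proof.
have := transvectant_linear_r n P (-1) 0 0.
by rewrite scaler0 addr0 scaleN1r addNr.
Qed.

Lemma transvectantZr n c P Q :
  transvectant n P (c *: Q) = c *: transvectant n P Q.
Proof.
have := transvectant_linear_r n P c Q 0.
by rewrite transvectant0r !addr0.
Qed.

Lemma transvectant_suml n (I : finType) (P : I -> {mpoly K[2]}) Q :
  transvectant n (\sum_i P i) Q = \sum_i transvectant n (P i) Q.
Proof.
elim/big_rec2: _ => [|i S T _ <-]; last by rewrite transvectantDl.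
exact: transvectant0l.
Qed.

Lemma transvectant_sumr n (I : finType) P (Q : I -> {mpoly K[2]}) :
  transvectant n P (\sum_i Q i) = \sum_i transvectant n P (Q i).
Proof.
elim/big_rec2: _ => [|i S T _ <-]; last by rewrite transvectantDr.
exact: transvectant0r.
Qed.

(** The alternating expression scales by a determinant: the terms in [P, Q] and in [P', Q']
    cancel. *)
Lemma transvectant_det n a b c d P P' Q Q' :
  transvectant n (a *: P + b *: P') (c *: Q + d *: Q') -
    transvectant n (c *: P + d *: P') (a *: Q + b *: Q') =
  (a * d - b * c) *: (transvectant n P Q' - transvectant n P' Q).
Proof.
rewrite !transvectantDl !transvectantZl !transvectantDr !transvectantZr.
by rewrite -!mul_mpolyC rmorphB !rmorphM /=; ring.
Qed.

(** Each level of the recursion contributes one factor [\det g], through the chain rule and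
    [transvectant_det]. *)
Lemma transvectant_lin_subst n g P Q :
  transvectant n (lin_subst g P) (lin_subst g Q) =
    \det g ^+ n *: lin_subst g (transvectant n P Q).
Proof.
elim: n P Q => [|n IHn] P Q /=; first by rewrite scale1r lin_substM.
rewrite !mderiv_lin_subst2.
rewrite transvectant_det !IHn -scalerBr scalerA -det_ord2 -exprS.
by rewrite /lin_subst -comp_mpolyB.
Qed.

Lemma transvectant_homog n r t P Q : P \is r.-homog -> Q \is t.-homog ->
  (n <= r)%N -> (n <= t)%N -> transvectant n P Q \is (r + t - 2 * n).-homog.
Proof.
elim: n r t P Q => [|n IHn] r t P Q homP homQ; first by rewrite subn0 dhomogM.
case: r t homP homQ => [//|r] [//|t] homP homQ le_nr le_nt /=.
have -> : (r.+1 + t.+1 - 2 * n.+1 = r + t - 2 * n)%N.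
  by rewrite addSn addnS mulnS subnDA subSS subSS subn0.
by rewrite rpredB // IHn // mderiv_homog.
Qed.

(** Since d/dy kills powers of x and d/dx kills powers of y, only one of the two terms survives at
    each level. *)
Lemma transvectant_monomials n a b : (n <= a)%N -> (n <= b)%N ->
  transvectant n 'X_[U_(x) *+ a] 'X_[U_(y) *+ b] =
    (a ^_ n * b ^_ n)%:R *: 'X_[U_(x) *+ (a - n) + U_(y) *+ (b - n)].
Proof.
elim: n a b => [|n IHn] a b; first by rewrite !subn0 scale1r mpolyXD.
case: a b => [|a] [|b] //= le_na le_nb.
have dU (i : 'I_2) k : (U_(i) *+ k.+1 - U_(i) = U_(i) *+ k)%MM.
  by rewrite mulmS addmC addmK.
have dXi (i : 'I_2) k :
    ('X_[U_(i) *+ k.+1] : {mpoly K[2]})^`M(i) = k.+1%:R *: 'X_[U_(i) *+ k].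
  by rewrite mderivX dU mulmnE mnm1E eqxx mul1n.
have dX0 (i i' : 'I_2) k : i != i' ->
    ('X_[U_(i) *+ k] : {mpoly K[2]})^`M(i') = 0.
  by move=> ne_i; rewrite mderivX mulmnE mnm1E (negPf ne_i) mul0n scale0r.
rewrite !dXi (dX0 x y) // (dX0 y x) // transvectant0l subr0.
rewrite transvectantZl transvectantZr IHn // !scalerA -!natrM.
by rewrite !ffactSS !subSS mulnACA.
Qed.

End Transvectants.

(** * Bilinearity of the Kronecker product; matrices of bilinear maps *)

Section TensorMatrices.
Variable K : fieldType.

Lemma tprod_linear_l m1 n1 m2 n2 (B : 'M[K]_(m2, n2)) :
  linear (fun A : 'M[K]_(m1, n1) => tprod A B).
Proof.
elim: m1 => [|m1 IHm] c A A' /=; first by rewrite scaler0 addr0.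
by rewrite !linearP /= IHm -!trowbE linearP /= scale_col_mx add_col_mx.
Qed.

Lemma tprod_linear_r m1 n1 (A : 'M[K]_(m1, n1)) m2 n2 :
  linear (@tprod K m1 n1 A m2 n2).
Proof.
elim: m1 A => [|m1 IHm] A c B B' /=; first by rewrite scaler0 addr0.
by rewrite IHm linearP scale_col_mx add_col_mx.
Qed.

HB.instance Definition _ m1 n1 (A : 'M[K]_(m1, n1)) m2 n2 :=
  GRing.isLinear.Build K 'M[K]_(m2, n2) 'M[K]_(m1 * m2, n1 * n2) _
    (@tprod K m1 n1 A m2 n2) (@tprod_linear_r m1 n1 A m2 n2).

(* [tprod] with its arguments swapped, to carry linearity on the left. *)
Definition tprodr m1 n1 m2 n2 (B : 'M[K]_(m2, n2)) (A : 'M[K]_(m1, n1)) :=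
  tprod A B.

HB.instance Definition _ m1 n1 m2 n2 (B : 'M[K]_(m2, n2)) :=
  GRing.isLinear.Build K 'M[K]_(m1, n1) 'M[K]_(m1 * m2, n1 * n2) _
    (tprodr B) (@tprod_linear_l m1 n1 m2 n2 B).

Lemma tprod0l m1 n1 m2 n2 (B : 'M[K]_(m2, n2)) :
  tprod (0 : 'M_(m1, n1)) B = 0.
Proof. exact: (linear0 (tprodr B)). Qed.

Lemma tprod0r m1 n1 (A : 'M[K]_(m1, n1)) m2 n2 :
  tprod A (0 : 'M_(m2, n2)) = 0.
Proof. exact: (linear0 (@tprod _ _ _ A _ _)). Qed.

Lemma tprodZl m1 n1 m2 n2 c (A : 'M[K]_(m1, n1)) (B : 'M[K]_(m2, n2)) :
  tprod (c *: A) B = c *: tprod A B.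
Proof. exact: (linearZZ (tprodr B)). Qed.

Lemma tprodZr m1 n1 m2 n2 c (A : 'M[K]_(m1, n1)) (B : 'M[K]_(m2, n2)) :
  tprod A (c *: B) = c *: tprod A B.
Proof. exact: (linearZZ (@tprod _ _ _ A _ _)). Qed.

Lemma tprod_suml m1 n1 m2 n2 (I : finType) (A : I -> 'M[K]_(m1, n1))
    (B : 'M[K]_(m2, n2)) :
  tprod (\sum_i A i) B = \sum_i tprod (A i) B.
Proof. exact: (linear_sum (tprodr B)). Qed.

Lemma tprod_sumr m1 n1 m2 n2 (I : finType) (A : 'M[K]_(m1, n1))
    (B : I -> 'M[K]_(m2, n2)) :
  tprod A (\sum_i B i) = \sum_i tprod A (B i).
Proof. exact: (linear_sum (@tprod _ _ _ A _ _)). Qed.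

(** The identity is a sum of products of basis columns with basis rows, so the columns e_i (x) e_j
    detect equality. *)
Lemma tprod_delta_ext d m n (M N : 'M[K]_(d, m * n)) :
  (forall i j, M *m tprod (delta_mx i 0 : 'cV_m) (delta_mx j 0 : 'cV_n) =
               N *m tprod (delta_mx i 0 : 'cV_m) (delta_mx j 0 : 'cV_n)) ->
  M = N.
Proof.
move=> eqMN; rewrite -[M]mulmx1 -[N]mulmx1 -tprod1 !mx1_sum_delta.
rewrite tprod_suml !mulmx_sumr; apply: eq_bigr => i _.
rewrite tprod_sumr !mulmx_sumr; apply: eq_bigr => j _.
rewrite -(mul_delta_mx (0 : 'I_1) i i) -(mul_delta_mx (0 : 'I_1) j j).
by rewrite tprodE !mulmxA eqMN.
Qed.

(* The factor [1%:M : 'M_1] makes room for the determinant twist, which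
   V_twist implements as a tensor product with a 1 x 1 matrix. *)
Definition bilinear_mx m n d (T : 'I_m -> 'I_n -> 'cV[K]_d) :
    'M[K]_(d * 1, m * n) :=
  \sum_i \sum_j tprod (T i j) (1%:M : 'M_1) *m
    tprod (delta_mx 0 i : 'rV_m) (delta_mx 0 j : 'rV_n).

Lemma bilinear_mx_delta m n d (T : 'I_m -> 'I_n -> 'cV[K]_d) i j :
  bilinear_mx T *m tprod (delta_mx i 0 : 'cV_m) (delta_mx j 0 : 'cV_n) =
    tprod (T i j) (1%:M : 'M_1).
Proof.
rewrite /bilinear_mx mulmx_suml (bigD1 i) //= [X in _ + X]big1 => [|k ne_ki].
  rewrite addr0 mulmx_suml (bigD1 j) //= big1 => [|k ne_kj].
    rewrite addr0 -mulmxA -[X in _ *m X]tprodE !mul_delta_mx.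
    have -> : delta_mx 0 0 = 1%:M :> 'M[K]_1 by rewrite mx1_sum_delta big_ord1.
    by rewrite tprod1 mulmx1.
  rewrite -mulmxA -[X in _ *m X]tprodE [delta_mx 0 k *m _]mul_delta_mx_0 //.
  by rewrite tprod0r mulmx0.
rewrite mulmx_suml big1 // => l _.
rewrite -mulmxA -[X in _ *m X]tprodE [delta_mx 0 k *m _]mul_delta_mx_0 //.
by rewrite tprod0l mulmx0.
Qed.

End TensorMatrices.

Local Arguments tprod : simpl never.

(** * The transvectants as nonzero intertwining matrices *)

Section TransvectantMatrix.
Variable K : fieldType.

Definition sym_coef r (P : {mpoly K[2]}) : 'cV[K]_r.+1 :=
  \col_i P@_(sym_mon i).

Lemma sym_coef_is_linear r : linear (sym_coef r).
Proof.
by move=> c P Q; apply/matrixP => i j; rewrite !mxE mcoeffD mcoeffZ.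
Qed.

HB.instance Definition _ r := GRing.isLinear.Build K {mpoly K[2]} 'cV[K]_r.+1 _
  (sym_coef r) (@sym_coef_is_linear r).

Lemma sym_monX_homog r (i : 'I_r.+1) : ('X_[sym_mon i] : {mpoly K[2]}) \is r.-homog.
Proof. by rewrite dhomogX /= mdeg_sym_mon. Qed.

Lemma sym_coefX r (i : 'I_r.+1) : sym_coef r 'X_[sym_mon i] = delta_mx i 0.
Proof.
apply/matrixP => k l; rewrite !mxE mcoeffX (inj_eq (@sym_mon_inj r)) ord1.
by rewrite eq_sym andbT.
Qed.

Lemma sym_mx_delta r g (i : 'I_r.+1) :
  sym_mx r g *m delta_mx i 0 = sym_coef r (lin_subst g 'X_[sym_mon i]).
Proof. by rewrite -sym_coefX -sym_mxP // sym_monX_homog. Qed.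

Variables (r t n : nat).

Definition transvectant_mx : 'M[K]_((r + t - 2 * n).+1 * 1, r.+1 * t.+1) :=
  bilinear_mx (fun i j =>
    sym_coef _ (transvectant n 'X_[@sym_mon r i] 'X_[@sym_mon t j])).

Lemma transvectant_mxE P Q : P \is r.-homog -> Q \is t.-homog ->
  transvectant_mx *m tprod (sym_coef r P) (sym_coef t Q) =
    tprod (sym_coef _ (transvectant n P Q)) (1%:M : 'M_1).
Proof.
move=> /homog_symE-> /homog_symE->.
rewrite ![sym_coef _ (\sum_i _)]linear_sum !tprod_suml mulmx_sumr.
rewrite transvectant_suml linear_sum tprod_suml; apply: eq_bigr => i _.
rewrite tprod_sumr mulmx_sumr transvectant_sumr linear_sum tprod_suml.
apply: eq_bigr => j _ /=.
rewrite transvectantZl transvectantZr !linearZ /= !tprodZl !sym_coefX.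
by rewrite -!scalemxAr bilinear_mx_delta !scalerA mulrC.
Qed.

Hypotheses (le_nr : (n <= r)%N) (le_nt : (n <= t)%N).

(** On a tensor of two basis monomials this is [transvectant_lin_subst] read in coordinates. *)
Lemma transvectant_mx_hom g :
  tprod (sym_mx _ g) ((\det g ^+ n)%:M : 'M_1) *m transvectant_mx =
    transvectant_mx *m tprod (sym_mx r g) (sym_mx t g).
Proof.
apply: tprod_delta_ext => i j; rewrite -!mulmxA -tprodE !sym_mx_delta.
rewrite transvectant_mxE ?lin_subst_homog ?sym_monX_homog //.
rewrite bilinear_mx_delta -tprodE mulmx1 transvectant_lin_subst.
rewrite -scalemx1 tprodZr linearZ /= tprodZl; congr (_ *: tprod _ _).
by rewrite -sym_mxP // transvectant_homog ?sym_monX_homog.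
Qed.

Lemma transvectant_mx_neq0 :
  (r ^_ n * t ^_ n)%:R != 0 :> K -> transvectant_mx != 0.
Proof.
apply: contra_neq => T0.
pose P : {mpoly K[2]} := 'X_[U_(ord0) *+ r].
pose Q : {mpoly K[2]} := 'X_[U_(ord_max) *+ t].
have homP : P \is r.-homog by rewrite dhomogX /= mdegMn mdeg1 mul1n.
have homQ : Q \is t.-homog by rewrite dhomogX /= mdegMn mdeg1 mul1n.
have := transvectant_mxE homP homQ; rewrite T0 mul0mx => /esym cPQ0.
(* Contracting [cPQ0] with the k-th basis row isolates the k-th coefficient, and a homogeneous
   polynomial is determined by these coefficients. *)
have {cPQ0} PQ0 : transvectant n P Q = 0.
  rewrite (homog_symE (transvectant_homog homP homQ le_nr le_nt)) big1 // => k _.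
  have := congr1 (mulmx (tprod (delta_mx 0 k : 'rV_(r + t - 2 * n).+1)
    (1%:M : 'M_1))) cPQ0.
  rewrite mulmx0 -tprodE mulmx1 -rowE.
  rewrite (_ : row k _ = (transvectant n P Q)@_(sym_mon k) *: 1%:M); last first.
    by apply/matrixP => a b; rewrite !mxE !ord1 eqxx mulr1.
  rewrite tprodZl tprod1 => /matrixP/(_ 0 0); rewrite !mxE eqxx mulr1 => ->.
  by rewrite scale0r.
move: PQ0; rewrite transvectant_monomials //.
move/mpolyP/(_ (U_(ord0) *+ (r - n) + U_(ord_max) *+ (t - n))%MM).
by rewrite mcoeffZ mcoeffX eqxx mulr1 mcoeff0.
Qed.

End TransvectantMatrix.

(** * Irreducibility of twisted symmetric powers in small degree *)

Section SymIrreducible.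
Variables (K : fieldType) (F : finFieldType) (sigma : {rmorphism F -> K}).

Lemma sym_det_mx_repr r k : mx_repr 'GL_2[F] (fun g =>
  sigma (\det (GLval g)) ^+ k *: sym_mx r (map_mx sigma (GLval g))).
Proof.
have [S1 SM] := sym_mx_repr sigma r; split=> [|g h Gg Gh].
  by rewrite S1 GL_1E det1 rmorph1 expr1n scale1r.
rewrite SM // GL_MxE det_mulmx rmorphM exprMn.
by rewrite -scalemxAl -scalemxAr scalerA.
Qed.

(** A model of [V_twist] of size [r.+1] instead of [r.+1 * 1], where submodules can be studied on
    plain row vectors. *)
Definition sym_det_repr r k : representation K 'GL_2[F]%G :=
  Representation (MxRepresentation (sym_det_mx_repr r k)).

Lemma sym_det_rsim r k : mx_rsim (sym_det_repr r k) (V_twist sigma r k).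
Proof.
(* The intertwiner sends e_j to e_j (x) 1; the columns [f j] give its inverse. *)
pose e (j : 'I_r.+1) : 'rV[K]_(r.+1 * 1) :=
  tprod (delta_mx 0 j : 'rV_r.+1) (1%:M : 'M_1).
pose f (j : 'I_r.+1) : 'cV[K]_(r.+1 * 1) :=
  tprod (delta_mx j 0 : 'cV_r.+1) (1%:M : 'M_1).
exists (\matrix_j e j) => /= [||g _]; first by rewrite muln1.
  apply/row_freeP; exists (\matrix_(i, j) f j i 0); apply/matrixP => i j.
  transitivity ((e i *m f j) 0 0).
    by rewrite !mxE; apply: eq_bigr => l _; rewrite !mxE.
  transitivity ((tprod (delta_mx 0 i *m delta_mx j 0 : 'M_1) (1%:M : 'M_1)
    : 'M[K]_1) 0 0).
    by rewrite -[in RHS](mulmx1 1%:M) tprodE.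
  rewrite mul_delta_mx_cond [RHS]mxE.
  have -> : delta_mx 0 0 = 1%:M :> 'M[K]_1 by rewrite mx1_sum_delta big_ord1.
  case: (i == j); rewrite ?mulr1n ?mulr0n.
    by rewrite tprod1 mxE.
  by rewrite tprod0l mxE.
apply/row_matrixP => i; rewrite !row_mul rowK.
set c := _ ^+ k; set S := sym_mx _ _.
transitivity (tprod (row i S) (c%:M : 'M_1) : 'rV[K]_(r.+1 * 1)); last first.
  by rewrite rowE -[c%:M in LHS]mul1mx tprodE.
rewrite -scalemx1 tprodZr [row i S in RHS]row_sum_delta tprod_suml scaler_sumr.
rewrite mulmx_sum_row; apply: eq_bigr => j _.
by rewrite tprodZl rowK !mxE scalerA.
Qed.

(* Modulo [U] each coordinate of the curve is a polynomial with #|F| roots. *)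
Lemma curve_submx n d m (U : 'M[K]_(d, m)) (w : nat -> 'rV[K]_m) :
  (n <= #|F|)%N -> (forall t, ((\sum_(i < n) sigma t ^+ i *: w i)%R <= U)%MS) ->
  forall i, (i < n)%N -> (w i <= U)%MS.
Proof.
move=> le_nF wU i lt_in; rewrite submxE; apply/eqP/rowP => c.
pose p := \poly_(k < n) (w k *m cokermx U) 0 c.
suff /polyP/(_ i) : p = 0 by rewrite /p coef_poly lt_in coef0 => ->; rewrite mxE.
apply/eqP/negPn/negP => nz_p.
have rootp : all (root p) [seq sigma t | t <- enum F].
  apply/allP => _ /mapP[t _ ->]; have := wU t.
  rewrite submxE rootE => /eqP/rowP/(_ c); rewrite mulmx_suml summxE mxE => w0.
  rewrite horner_poly -[X in _ == X]w0; apply/eqP/eq_bigr => l _.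
  by rewrite -scalemxAl [in RHS]mxE mulrC.
have uniq_roots : uniq [seq sigma t | t <- enum F].
  by rewrite map_inj_uniq ?enum_uniq //; apply: fmorph_inj.
have := max_poly_roots nz_p rootp uniq_roots.
rewrite size_map -cardE ltnNge => /negP; apply.
exact: leq_trans (size_poly _ _) le_nF.
Qed.

Definition upper_unip (R : fieldType) (t : R) : 'M[R]_2 :=
  1%:M + t *: delta_mx ord0 ord_max.

Lemma det_upper_unip (R : fieldType) (t : R) : \det (upper_unip t) = 1.
Proof. by rewrite det_ord2 !mxE /= !mulr0 !addr0 mulr1 mulr0 subr0. Qed.

Lemma sym_monXE r (i : 'I_r.+1) :
  'X_[sym_mon i] = 'X_ord0 ^+ (r - i) * 'X_ord_max ^+ i :> {mpoly K[2]}.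
Proof.
rewrite mpolyXE_id big_ord_recl big_ord1 !mnmE /=; congr (_ * 'X_ _ ^+ _).
Qed.

(** The substitution fixes x and sends y to tx + y, so this is the binomial theorem; [inord] is
    harmless because [k <= j <= r]. *)
Lemma lin_subst_upper_unip (t : K) r (j : 'I_r.+1) :
  lin_subst (upper_unip t) 'X_[sym_mon j] =
    \sum_(k < j.+1)
      (t ^+ (j - k) *+ 'C(j, k)) *: 'X_[sym_mon (inord k : 'I_r.+1)].
Proof.
rewrite sym_monXE lin_substM /lin_subst !rmorphXn /=.
rewrite -!/(lin_subst _ _) !lin_substX !big_ord2 !mxE /= !mulr0 mulr1 addr0.
rewrite add0r !scale0r !scale1r !addr0 exprDn mulr_sumr; apply: eq_bigr => k _.
have le_kj : (k <= j)%N by rewrite -ltnS.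
have le_jr : (j <= r)%N by rewrite -ltnS.
rewrite sym_monXE inordK ?ltnS ?(leq_trans le_kj) // exprZn -mulrnAr.
rewrite -[in RHS]mulr_natr -scalerA scaler_nat -scalerAl -scalerAr -!mulrnAr.
rewrite mulrA -exprD; congr (_ *: ('X_ord0 ^+ _ * _)).
  by rewrite add0r.
by rewrite addnBA // subnK.
Qed.

Definition unip_coef r m : 'M[K]_r.+1 :=
  \matrix_(i, j) if (j == i + m :> nat)%N then 'C(j, i)%:R else 0.

Lemma sym_mx_upper_unip (t : K) r :
  sym_mx r (upper_unip t) = \sum_(m < r.+1) t ^+ m *: unip_coef r m.
Proof.
apply/matrixP => i j; rewrite mxE lin_subst_upper_unip summxE raddf_sum /=.
under eq_bigr do rewrite mcoeffZ mcoeffX (inj_eq (@sym_mon_inj r)).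
under [RHS]eq_bigr do rewrite !mxE.
(* The entry at [(i, j)] involves only the power [t ^+ (j - i)], and is zero when [j < i]. *)
have [le_ij | lt_ji] := leqP i j; last first.
  rewrite big1 ?[RHS]big1 // => m _.
    case: eqP => [def_j|]; last by rewrite mulr0.
    by rewrite def_j ltnNge leq_addr in lt_ji.
  case: eqP => [def_i|]; last by rewrite mulr0.
  have lt_mr : (m < r.+1)%N by apply: leq_ltn_trans (ltn_ord j); rewrite -ltnS.
  by move: lt_ji; rewrite -def_i inordK // ltnNge -ltnS ltn_ord.
have lt_i : (i < j.+1)%N by rewrite ltnS.
have lt_d : (j - i < r.+1)%N by apply: leq_ltn_trans (ltn_ord j); apply: leq_subr.
rewrite (bigD1 (Ordinal lt_i)) //= (bigD1 (Ordinal lt_d)) //=.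
rewrite inord_val eqxx subnKC // eqxx mulr1 mulr_natr big1 ?[in RHS]big1 // => m.
  rewrite -val_eqE /= => ne_m; case: eqP => [def_j|]; last by rewrite mulr0.
  by rewrite def_j addKn eqxx in ne_m.
rewrite -val_eqE /= => ne_m; case: eqP => [def_i|]; last by rewrite mulr0.
have lt_mr : (m < r.+1)%N by apply: leq_ltn_trans (ltn_ord j); rewrite -ltnS.
by rewrite -def_i inordK // eqxx in ne_m.
Qed.

Definition swap_mx (R : fieldType) : 'M[R]_2 := \matrix_(i, j) (i != j)%:R.

Lemma det_swap_mx (R : fieldType) : \det (swap_mx R) = -1.
Proof. by rewrite det_ord2 !mxE /= mulr0 mulr1 sub0r. Qed.

(** Exchanging x and y reverses the monomial basis. *)
Lemma sym_mx_swap r :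
  sym_mx r (swap_mx K) = \matrix_(i, j) (i == rev_ord j)%:R.
Proof.
apply/matrixP => i j; rewrite !mxE sym_monXE lin_substM /lin_subst !rmorphXn /=.
rewrite -!/(lin_subst _ _) !lin_substX !big_ord2 !mxE /=.
rewrite !scale0r !scale1r addr0 add0r.
have -> : 'X_ord_max ^+ (r - j) * 'X_ord0 ^+ j =
    'X_[sym_mon (rev_ord j)] :> {mpoly K[2]}.
  by rewrite sym_monXE /= subSS subKn 1?mulrC // -ltnS.
by rewrite mcoeffX (inj_eq (@sym_mon_inj r)) eq_sym.
Qed.

Lemma GL2_elt (M : 'M[F]_2) : \det M != 0 ->
  exists g : {'GL_2[F]}, GLval g = M.
Proof.
move=> nz_det; have uM : M \is a GRing.unit.
  by rewrite -[_ \is a _]/(M \in unitmx) unitmxE unitfE.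
by exists (FinRing.unit _ uM).
Qed.

(* The operators [unip_coef r m] are the divided powers of the nilpotent
   generator; they send any nonzero row to the last basis row, the swap moves
   it to the first one, and from there they reach the whole basis. *)
Lemma sym_det_irr r k : (r < #|F|)%N -> r`!%:R != 0 :> K ->
  mx_irreducible (sym_det_repr r k).
Proof.
move=> lt_rF nz_fact; apply/mx_irrP; split=> // U modU nzU.
(* The images of [v] under the unipotents of determinant 1 trace a curve of degree at most [r]
   inside [U]; as [r < #|F|], its coefficients lie in [U] too. *)
have unipU m (v : 'rV_r.+1) :
    (v <= U)%MS -> (m < r.+1)%N -> (v *m unip_coef r m <= U)%MS.
  move=> vU; move: m; apply: (@curve_submx _ _ _ U (fun i => v *m _) lt_rF) => t.
  have [|g def_g] := @GL2_elt (upper_unip t).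
    by rewrite det_upper_unip oner_eq0.
  have := mxmodule_trans modU (in_setT g) vU.
  rewrite /= def_g det_upper_unip rmorph1 expr1n scale1r.
  have -> : map_mx sigma (upper_unip t) = upper_unip (sigma t).
    by rewrite /upper_unip map_mxD map_mx1 map_mxZ map_delta_mx.
  rewrite sym_mx_upper_unip mulmx_sumr.
  by congr (_ <= _)%MS; apply: eq_bigr => i _; rewrite -scalemxAr.
have swapU (v : 'rV_r.+1) : (v <= U)%MS -> (v *m sym_mx r (swap_mx K) <= U)%MS.
  move=> vU.
  have [|g def_g] := @GL2_elt (swap_mx F).
    by rewrite det_swap_mx oppr_eq0 oner_eq0.
  have := mxmodule_trans modU (in_setT g) vU.
  rewrite /= def_g det_swap_mx rmorphN1 -scalemxAr.
  have -> : map_mx sigma (swap_mx F) = swap_mx K.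
    by apply/matrixP => i j; rewrite !mxE rmorph_nat.
  by rewrite eqmx_scale // signr_eq0.
have nz_bin i : (i <= r)%N -> 'C(r, i)%:R != 0 :> K.
  move=> le_ir; apply: contraNneq nz_fact => bin0.
  by rewrite -(bin_fact le_ir) natrM bin0 mul0r.
have e_maxU : ((delta_mx 0 ord_max : 'rV_r.+1) <= U)%MS.
  have nz_v : nz_row U != 0 by rewrite nz_row_eq0.
  set v := nz_row U in nz_v; have vU : (v <= U)%MS by apply: nz_row_sub.
  have [i1 nz_vi1] : exists i, v 0 i != 0 by apply/rV0Pn.
  (* Take the least index [i] in the support of [v]. Shifting by [r - i] puts e_i in the last place
     and pushes every later basis row out of range. *)
  have := @arg_minnP _ i1 (fun i => v 0 i != 0) val nz_vi1.
  case=> i nz_vi min_i.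
  have le_ir : (i <= r)%N by rewrite -ltnS.
  have lt_d : (r - i < r.+1)%N by rewrite ltnS leq_subr.
  have := unipU _ v vU lt_d.
  have -> : v *m unip_coef r (r - i) = (v 0 i * 'C(r, i)%:R) *: delta_mx 0 ord_max.
    apply/rowP => j; rewrite !mxE /=.
    rewrite (bigD1 i) //= mxE subnKC // big1 ?addr0 => [|l ne_li].
      by rewrite -val_eqE /=; case: eqP => [->|]; rewrite ?mulr1 ?mulr0.
    rewrite mxE; case: eqP => [def_j|]; last by rewrite mulr0.
    have [->|/min_i le_il] := eqVneq (v 0 l) 0; first by rewrite mul0r.
    case/eqP: ne_li; apply: val_inj; apply/anti_leq; rewrite le_il andbT.
    by rewrite -(leq_add2r (r - i)) subnKC // -def_j -ltnS.
  by rewrite eqmx_scale // mulf_neq0 ?nz_bin.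
have e0U : ((delta_mx 0 ord0 : 'rV_r.+1) <= U)%MS.
  have := swapU _ e_maxU; rewrite -rowE sym_mx_swap.
  congr (_ <= _)%MS; apply/rowP => j; rewrite !mxE -!val_eqE /= subSS.
  by rewrite -{1}[r]subn0 eqn_sub2lE // ?[(j <= _)%N]leq_ord // eq_sym.
rewrite -sub1mx; apply/row_subP => j; rewrite row1.
(* Row 0 of [unip_coef r j] is exactly e_j, since its coefficient is ['C(j, 0)], that is 1. *)
have := unipU j _ e0U (ltn_ord j); rewrite -rowE; congr (_ <= _)%MS.
apply/rowP => l; rewrite !mxE -!val_eqE /= add0n bin0.
by case: eqP.
Qed.

End SymIrreducible.

(** * Clebsch-Gordan decomposition and its two applications *)

Lemma tensor_rsim (K : fieldType) (gT : finGroupType) (G : {group gT})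
    (A A' B B' : representation K G) :
  mx_rsim A A' -> mx_rsim B B' -> mx_rsim (tensor_repr A B) (tensor_repr A' B').
Proof.
move=> [f eqA /row_freeP[f' fK] homf] [h eqB /row_freeP[h' hK] homh].
exists (tprod f h) => /= [||g Gg]; first by rewrite eqA eqB.
  by apply/row_freeP; exists (tprod f' h'); rewrite -tprodE fK hK tprod1.
by rewrite -!tprodE homf // homh.
Qed.

Lemma Sym_rsim_twist0 (K : fieldType) (F : finFieldType)
    (sigma : {rmorphism F -> K}) r :
  mx_rsim (Sym_repr sigma r) (V_twist sigma r 0).
Proof.
apply: mx_rsim_trans (sym_det_rsim sigma r 0); exists 1%:M => // [|g _] /=.
  by rewrite /row_free mxrank1.
by rewrite mul1mx mulmx1 expr0 scale1r.
Qed.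

Lemma natr_fact_neq0 (R : idomainType) p n :
  p \in [pchar R] -> (n < p)%N -> n`!%:R != 0 :> R.
Proof.
move=> charR; elim: n => [|n IHn] lt_np; first by rewrite oner_eq0.
rewrite factS natrM mulf_neq0 ?IHn ?(ltnW lt_np) //.
by rewrite -(dvdn_pcharf charR) gtnNdvd.
Qed.

(** For [m = minn r t] the right side is [r.+1 * t.+1], the dimension of the tensor product. *)
Lemma sum_clebsch_gordan_degrees r t m : (m <= minn r t)%N ->
  (\sum_(i < m.+1) (r + t - 2 * i).+1 = m.+1 * (r + t - m).+1)%N.
Proof.
elim: m => [|m IHm] le_m; first by rewrite big_ord1 muln0 mul1n.
rewrite big_ord_recr /= IHm; lia.
Qed.

(** Allowing any [rG] similar to the tensor product covers both the restricted representation and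
    the product of zero twists; the similarity [B] carries the transvectants over to [rG]. *)
Lemma clebsch_gordan_semisimplification (K : fieldType) (F : finFieldType)
    (sigma : {rmorphism F -> K}) p r t
    (rG : representation K 'GL_2[F]%G) :
  p \in [pchar K] -> (r + t < p)%N -> (p <= #|F|)%N ->
  mx_rsim (tensor_repr (Sym_repr sigma r) (Sym_repr sigma t)) rG ->
  mx_rsim (semisimplification rG)
    (\big[@dadd_grepr K _ _/grepr0]_(i < (minn r t).+1)
       V_twist sigma (r + t - 2 * i) i).
Proof.
move=> charK lt_rt le_pF [B eq_deg freeB homB].
have le_min i : (i < (minn r t).+1)%N -> (i <= r)%N /\ (i <= t)%N by lia.
apply: (@semisimplification_distinct_degrees _ _ _ rG _
  (fun i => V_twist sigma (r + t - 2 * i) i)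
  (fun i => transvectant_mx K r t i *m B)) => [i _|i lt_i|i lt_i g Gg|i j lt_ij|].
- apply: mx_rsim_irr (sym_det_rsim sigma _ _) (sym_det_irr _ _ _ _).
    lia.
  by apply: (natr_fact_neq0 charK); lia.
- have [le_ir le_it] := le_min i lt_i.
  suff nzT : transvectant_mx K r t i != 0.
    by rewrite -mxrank_eq0 mxrankMfree // mxrank_eq0.
  (* The falling factorials divide [r]! and [t]!, which are prime to p because [r] and [t] are below
     p. *)
  apply: transvectant_mx_neq0 => //; rewrite natrM mulf_neq0 //.
    have := natr_fact_neq0 charK (leq_ltn_trans (leq_addr t r) lt_rt).
    by rewrite -(ffact_fact le_ir) natrM mulf_eq0 negb_or => /andP[].
  have := natr_fact_neq0 charK (leq_ltn_trans (leq_addl r t) lt_rt).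
  by rewrite -(ffact_fact le_it) natrM mulf_eq0 negb_or => /andP[].
- have [le_ir le_it] := le_min i lt_i.
  rewrite -[RHS]mulmxA -homB // [LHS]mulmxA [RHS]mulmxA /= -det_map_mx.
  by congr (_ *m B); apply: transvectant_mx_hom.
(* Indices are at most [minn r t], so the subtraction is exact and the degrees strictly decrease. *)
- rewrite /= !muln1 eqSS; lia.
rewrite -eq_deg /=; under eq_bigr do rewrite muln1.
rewrite sum_clebsch_gordan_degrees //; nia.
Qed.

Theorem theorem3p1
  (p : nat) (p_pr : prime p)
  (* K is an algebraic closure of F_p *)
  (K : closedFieldType) (iota : {rmorphism 'F_p -> K})
  (K_alg : integralRange iota)
  (* Fq is the field with q = p^2 elements, with F_p < Fq < K *)
  (Fq : finFieldType) (card_Fq : #|Fq| = (p ^ 2)%N)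
  (j : {rmorphism 'F_p -> Fq}) (iotaq : {rmorphism Fq -> K})
  (r1 r2 : nat) (lt_r1 : (r1 < p)%N) (lt_r2 : (r2 < p)%N)
  (lt_r12 : (r1 + r2 < p)%N) :
  let charFq := rmorph_pchar j (pchar_Fp p_pr) in
  mx_rsim
    (semisimplification (restrict_GL2 j (V_pair charFq iotaq r1 r2)))
    (semisimplification (tensor_repr (V_twist iota r1 0) (V_twist iota r2 0)))
  /\
  mx_rsim
    (semisimplification (tensor_repr (V_twist iota r1 0) (V_twist iota r2 0)))
    (\big[@dadd_grepr K _ _/grepr0]_(i < (minn r1 r2).+1)
       V_twist iota (r1 + r2 - 2 * i) i).
Proof.
move=> charFq.
have charK : p \in [pchar K] := rmorph_pchar iota (pchar_Fp p_pr).
have le_pF : (p <= #|'F_p|)%N by rewrite card_Fp.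
have CG := clebsch_gordan_semisimplification charK lt_r12 le_pF.
have ss_tensor :=
  CG iota _ (tensor_rsim (Sym_rsim_twist0 _ _) (Sym_rsim_twist0 _ _)).
split; last exact: ss_tensor.
apply: mx_rsim_trans (mx_rsim_sym ss_tensor); apply: CG.
exists 1%:M => // [|g _] /=; first by rewrite /row_free mxrank1.
(* Every element of the prime field is the image of a natural number, which ring morphisms preserve.
   Hence the embeddings into [K] agree on it, with or without Frobenius. *)
have iotaE (a : 'F_p) : iotaq (j a) = iota a.
  by rewrite -[a]natr_Zp !rmorph_nat.
have frobE (a : 'F_p) : iotaq (pFrobenius_aut charFq (j a)) = iota a.
  by rewrite -[a]natr_Zp !rmorph_nat.
have eq1 : map_mx iotaq (map_mx j (GLval g)) = map_mx iota (GLval g).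
  by apply/matrixP => a b; rewrite !mxE iotaE.
have eq2 : map_mx (iotaq \o pFrobenius_aut charFq) (map_mx j (GLval g)) =
    map_mx iota (GLval g).
  by apply/matrixP => a b; rewrite !mxE /= frobE.
by rewrite mul1mx mulmx1 eq1 eq2.
Qed.
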